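(* For all $n\ge2$, we have $$c_n(123,231)=\frac{n^2+5n-6}{2}.$$
   Context: A word $\pi=\pi_1\dots\pi_m$ over the positive integers contains the pattern $\sigma=\sigma_1\dots\sigma_k$ if there are indices $1\le i_1<\dots<i_k\le m$ such that for all $r,s\in\{1,\dots,k\}$: $\pi_{i_r}<\pi_{i_s}$ iff $\sigma_r<\sigma_s$, and $\pi_{i_r}=\pi_{i_s}$ iff $\sigma_r=\sigma_s$; otherwise $\pi$ avoids $\sigma$. $\mathcal{C}_n$ denotes the set of nonnesting permutations: arrangements (words) of the multiset $\{1,1,2,2,\dots,n,n\}$ that avoid the patterns $1221$ and $2112$. For patterns $\sigma,\tau,\dots$, $c_n(\sigma,\tau,\dots)$ is the number of $\pi\in\mathcal{C}_n$ avoiding all of $\sigma,\tau,\dots$. *)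

(* Defs.v *)
From mathcomp Require Import all_boot all_order all_algebra.

Set Implicit Arguments.
Unset Strict Implicit.
Unset Printing Implicit Defensive.

Local Open Scope nat_scope.

(* Words are sequences of natural numbers; the function f lists the (strictly
   increasing) positions of an occurrence of the pattern sigma in w. *)
Definition contains (w sigma : seq nat) : bool :=
  [exists f : {ffun 'I_(size sigma) -> 'I_(size w)},
    [forall r : 'I_(size sigma), forall s : 'I_(size sigma),
      [&& (r < s) ==> (f r < f s),
          (nth 0 w (f r) < nth 0 w (f s)) == (nth 0 sigma r < nth 0 sigma s)
        & (nth 0 w (f r) == nth 0 w (f s))
            == (nth 0 sigma r == nth 0 sigma s)]]].

Definition avoids (w sigma : seq nat) : bool := ~~ contains w sigma.

Definition double_word (n : nat) : seq nat :=
  flatten [seq [:: i; i] | i <- iota 1 n].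

(* [permutations s] lists every rearrangement of s exactly once, even when s
   has repeated entries, so the size of this list is the cardinality of C_n. *)
Definition nonnesting_permutations (n : nat) : seq (seq nat) :=
  [seq w <- permutations (double_word n)
     | avoids w [:: 1; 2; 2; 1] && avoids w [:: 2; 1; 1; 2]].

Definition c (n : nat) (patterns : seq (seq nat)) : nat :=
  size [seq w <- nonnesting_permutations n | all (avoids w) patterns].

(* Main.v *)
Require Import Defs.
From mathcomp Require Import all_boot all_order all_algebra.
From mathcomp Require Import zify lra.
Import GRing.Theory.

(** For n >= 3 the avoiders of size n fall into two classes.

    An avoider starting with n n is n n followed by an arbitrary avoider of
    size n - 1: the largest letter in front of a word cannot play the first
    letter of 123 or of 231, and it is adjacent to its twin.

    There are n + 2 others, and they can be listed.
    - Suppose that the first letter is k < n. Since k stands in front, 231 forces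
      every letter below k to come before every letter above k, and 123 forces
      the letters above k to decrease weakly. The letters below k also decrease
      weakly, because an ascent among them followed by the n to their right would
      be a 123. So the word without its two k is
      (k-1)(k-1)...11 nn...(k+1)(k+1), and it only remains to place the second k:
      nonnesting and 123 put it next to the first one, except that for k = 1 it may
      also stand between the two n. This is [avoider_first_lt]; it gives n - 1
      words and the word 1n1n(n-1)(n-1)...22.
    - Suppose that the word starts with n k, k < n. If 1 < k, both 1 would come
      before the second n because of 231, which nests them inside the pair of n.
      So k = 1, the letters other than 1 decrease weakly, and nonnesting leaves
      two places for the second 1. This is [avoider_first_max].

    Hence c_n = c_(n-1) + n + 2 for n >= 3, and c_2 = 4.

    Pattern containment is first turned into statements about subsequences
    ([containsP], [pattern_freeP]). That the listed words avoid the patterns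
    needs two criteria: being sorted for the order k, k-1, ..., 1, n, ..., k+1
    ([pattern_free_rotated]), and being a decreasing word into which two letters 1
    were inserted ([pattern_free_insert_ones]). *)
Set Implicit Arguments.
Unset Strict Implicit.
Unset Printing Implicit Defensive.

Local Open Scope nat_scope.

(** * Containment as a statement on subsequences *)
Definition order_isomorphic (v sigma : seq nat) : Prop :=
  size v = size sigma /\
  forall r s, r < size sigma -> s < size sigma ->
    (nth 0 v r < nth 0 v s) = (nth 0 sigma r < nth 0 sigma s) /\
    (nth 0 v r == nth 0 v s) = (nth 0 sigma r == nth 0 sigma s).

(** An increasing list of positions is a subsequence of the list of all positions,
    so reading off the letters gives a subsequence of the word. *)
Lemma subseq_positions (w p : seq nat) :
  sorted ltn p -> all (gtn (size w)) p -> subseq [seq nth 0 w i | i <- p] w.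
Proof.
move=> p_sorted p_lt; rewrite -{2}(mkseq_nth 0 w); apply: map_subseq.
suff -> : p = [seq i <- iota 0 (size w) | i \in p] by exact: filter_subseq.
apply: (irr_sorted_eq ltn_trans ltnn) => // [|i].
  by rewrite sorted_filter ?iota_ltn_sorted //; exact: ltn_trans.
rewrite mem_filter mem_iota /= add0n andb_idr // => i_p.
exact: (allP p_lt).
Qed.

(** The finite function of positions in the definition of containment carries no
    more information than the letters found there; conversely the positions of a
    subsequence are recovered by applying its mask to the list of all positions. *)
Lemma containsP (w sigma : seq nat) :
  reflect (exists2 v, subseq v w & order_isomorphic v sigma)
          (contains w sigma).
Proof.
apply: (iffP existsP) => [[f /forallP fP] | [v v_w [sz_v v_iso]]].
  have fE (r s : 'I_(size sigma)) : [/\ r < s -> f r < f s,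
      (nth 0 w (f r) < nth 0 w (f s)) = (nth 0 sigma r < nth 0 sigma s)
    & (nth 0 w (f r) == nth 0 w (f s)) = (nth 0 sigma r == nth 0 sigma s)].
    by have /forallP/(_ s)/and3P[/implyP ? /eqP ? /eqP ?] := fP r.
  (* From the positions to the subsequence of letters. *)
  pose p := [seq val (f r) | r <- enum 'I_(size sigma)].
  exists [seq nth 0 w i | i <- p].
    apply: subseq_positions; last by apply/allP=> _ /mapP[r _ ->]; exact: ltn_ord.
    rewrite sorted_map.
    have := iota_ltn_sorted 0 (size sigma); rewrite -val_enum_ord sorted_map.
    by apply: sub_sorted => r s; case: (fE r s).
  split=> [|r s lt_r lt_s]; first by rewrite 2!size_map -cardE card_ord.
  have nthE t (lt_t : t < size sigma) :
      nth 0 [seq nth 0 w i | i <- p] t = nth 0 w (f (Ordinal lt_t)).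
    rewrite -map_comp (nth_map (Ordinal lt_t)) ?size_enum_ord //=.
    by congr (nth 0 w (f _)); apply: val_inj; rewrite /= nth_enum_ord.
  by rewrite (nthE _ lt_r) (nthE _ lt_s); case: (fE (Ordinal lt_r) (Ordinal lt_s)).
case/subseqP: v_w => m sz_m v_m.
(* From the mask of the subsequence to the positions. *)
pose p := mask m (iota 0 (size w)).
have sub_p : subseq p (iota 0 (size w)) by exact: mask_subseq.
have v_p : v = [seq nth 0 w i | i <- p].
  by rewrite /p map_mask -/(mkseq _ _) mkseq_nth.
have sz_p : size p = size sigma by rewrite -sz_v v_p size_map.
have p_sorted : sorted ltn p.
  exact: (subseq_sorted ltn_trans sub_p (iota_ltn_sorted _ _)).
have p_lt (r : 'I_(size sigma)) : nth 0 p r < size w.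
  have: nth 0 p r \in iota 0 (size w).
    by apply: (mem_subseq sub_p); rewrite mem_nth // sz_p ltn_ord.
  by rewrite mem_iota.
exists [ffun r => Ordinal (p_lt r)].
apply/forallP=> r; apply/forallP=> s; rewrite !ffunE /=.
have nthE (t : 'I_(size sigma)) : nth 0 w (nth 0 p t) = nth 0 v t.
  by rewrite v_p (nth_map 0) // sz_p ltn_ord.
rewrite !nthE; have [-> ->] := v_iso r s (ltn_ord r) (ltn_ord s).
rewrite !eqxx !andbT; apply/implyP=> lt_rs.
by apply: (sorted_ltn_nth ltn_trans) => //; rewrite inE sz_p ltn_ord.
Qed.

Lemma avoids_subseq w sigma v :
  avoids w sigma -> subseq v w -> order_isomorphic v sigma -> False.
Proof. by move=> /negP ncont v_w v_iso; apply: ncont; apply/containsP; exists v. Qed.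

(** The patterns 1221 and 2112 together say that no pair of equal letters
    encloses another one, whatever the order of the two letters: hence a single
    clause for both, without any comparison of a and b. *)
Record pattern_free (w : seq nat) : Prop := PatternFree {
  no_nesting : forall a b, subseq [:: a; b; b; a] w -> a = b;
  no_123 : forall a b d, a < b -> b < d -> subseq [:: a; b; d] w -> False;
  no_231 : forall a b d, a < b -> b < d -> subseq [:: b; d; a] w -> False
}.

Lemma pattern_freeP w :
  reflect (pattern_free w) [&& avoids w [:: 1; 2; 2; 1], avoids w [:: 2; 1; 1; 2],
                       avoids w [:: 1; 2; 3] & avoids w [:: 2; 3; 1]].
Proof.
apply: (iffP and4P) => [[H1 H2 H3 H4]|[H1 H2 H3]].
  split=> [a b sub_w | a b d lt_ab lt_bd sub_w | a b d lt_ab lt_bd sub_w].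
  - case: (ltngtP a b) => // lt_ab; exfalso.
      apply: (avoids_subseq H1 sub_w).
      by split=> // -[|[|[|[|r]]]] -[|[|[|[|s]]]] //= _ _; split; lia.
    apply: (avoids_subseq H2 sub_w).
    by split=> // -[|[|[|[|r]]]] -[|[|[|[|s]]]] //= _ _; split; lia.
  - apply: (avoids_subseq H3 sub_w).
    by split=> // -[|[|[|r]]] -[|[|[|s]]] //= _ _; split; lia.
  - apply: (avoids_subseq H4 sub_w).
    by split=> // -[|[|[|r]]] -[|[|[|s]]] //= _ _; split; lia.
split; apply/containsP => -[v v_w []]; move: v v_w.
- case=> [|a [|b [|b' [|a' [|? ?]]]]] //= sub_w _ iso.
  have [lt_ab _] := iso 0 1 isT isT; have [_ eq_b] := iso 1 2 isT isT.
  have [_ eq_a] := iso 0 3 isT isT.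
  move/eqP: eq_a => /= eq_a; move/eqP: eq_b => /= eq_b; subst.
  by have := H1 _ _ sub_w; move: lt_ab => /=; lia.
- case=> [|a [|b [|b' [|a' [|? ?]]]]] //= sub_w _ iso.
  have [_ lt_ab] := iso 0 1 isT isT; have [_ eq_b] := iso 1 2 isT isT.
  have [_ eq_a] := iso 0 3 isT isT.
  move/eqP: eq_a => /= eq_a; move/eqP: eq_b => /= eq_b; subst.
  by have := H1 _ _ sub_w; move: lt_ab => /=; lia.
- case=> [|a [|b [|d [|? ?]]]] //= sub_w _ iso.
  have [lt_ab _] := iso 0 1 isT isT; have [lt_bd _] := iso 1 2 isT isT.
  exact: H2 lt_ab lt_bd sub_w.
- case=> [|b [|d [|a [|? ?]]]] //= sub_w _ iso.
  have [lt_ab _] := iso 2 0 isT isT; have [lt_bd _] := iso 0 1 isT isT.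
  exact: H3 lt_ab lt_bd sub_w.
Qed.

(** * Doubled decreasing words *)

(** [down a m] is the word (a+m)(a+m)...(a+1)(a+1). All the listed avoiders are
    made of such blocks, and [down 0 n] serves as the reference rearrangement of
    the multiset. *)
Fixpoint down (a m : nat) : seq nat :=
  if m is m'.+1 then [:: a + m, a + m & down a m'] else [::].

Lemma down_add a m p : down a (m + p) = down (a + m) p ++ down a m.
Proof. by elim: p => [|p IHp]; rewrite ?addn0 // addnS /= -addnS IHp addnA. Qed.

Lemma mem_down a m x : (x \in down a m) = (a < x <= a + m).
Proof. by elim: m => [|m IHm]; rewrite /= ?inE ?IHm ?in_nil; lia. Qed.

Lemma count_mem_down a m x : count_mem x (down a m) = (a < x <= a + m).*2.
Proof. by elim: m => [|m IHm] /=; [lia | rewrite IHm; lia]. Qed.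

Lemma perm_down_double_word n : perm_eq (down 0 n) (double_word n).
Proof.
elim: n => //= n IHn.
rewrite /double_word -(addn1 n) iotaD map_cat flatten_cat perm_sym perm_catC /=.
by rewrite add1n addn1 !perm_cons perm_sym.
Qed.

Lemma pairwise_geq_down a m : pairwise geq (down a m).
Proof.
elim: m => //= m ->; rewrite leqnn andbT /=.
suff -> : all (geq (a + m.+1)) (down a m) by [].
by apply/allP=> x; rewrite mem_down /=; lia.
Qed.

(** The order in which the values are read in an avoider that starts with k k,
    for k < n: first k, k-1, ..., 1, then n, n-1, ..., k+1. Since it is antisymmetric, a
    word sorted for it is determined by its multiset of letters. *)
Definition rotated_geq (k : nat) : rel nat :=
  fun x y => if x <= k then (k < y) || (y <= x) else k < y <= x.

Lemma rotated_geq_anti k : antisymmetric (rotated_geq k).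
Proof. by move=> x y; rewrite /rotated_geq; case: ifP; case: ifP; lia. Qed.

Lemma pairwise_rotated_down k m : pairwise (rotated_geq k) (down 0 k ++ down k m).
Proof.
rewrite pairwise_cat; apply/and3P; split.
- apply/allrelP=> x y; rewrite !mem_down /rotated_geq.
  by case: ifP; lia.
- apply: (sub_in_pairwise _ _ (pairwise_geq_down 0 k) (P := fun x => x <= k)).
    by move=> x y; rewrite !unfold_in /rotated_geq /=; case: ifP; lia.
  by apply/allP=> x; rewrite mem_down; lia.
apply: (sub_in_pairwise _ _ (pairwise_geq_down k m) (P := fun x => k < x)).
  by move=> x y; rewrite !unfold_in /rotated_geq /=; case: ifP; lia.
by apply/allP=> x; rewrite mem_down; lia.
Qed.

(** * Subsequences of length two *)

Lemma pairwise_subseq2 (r : rel nat) s x y :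
  pairwise r s -> subseq [:: x; y] s -> r x y.
Proof. by move=> r_s /subseq_pairwise/(_ r_s); rewrite pairwise2. Qed.

Lemma subseq2_pairwise (r : rel nat) s :
  (forall x y, subseq [:: x; y] s -> r x y) -> pairwise r s.
Proof.
elim: s => // z s IHs r_s; rewrite pairwise_cons; apply/andP; split.
  by apply/allP=> y y_s; apply: r_s; rewrite /= eqxx sub1seq.
by apply: IHs => x y xy_s; apply/r_s/(subseq_trans xy_s)/subseq_cons.
Qed.

(** Used with z the largest letter: it must stand either before y or after it. *)
Lemma subseq_insert (T : eqType) (x y z : T) s :
    subseq [:: x; y] s -> z \in s ->
  [\/ z = y, subseq [:: z; y] s | subseq [:: x; y; z] s].
Proof.
elim: s => // t s IHs; rewrite inE.
case: (z =P t) => [-> xy_s _ | /eqP/negPf ne_zt].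
  case: (y =P t) => [-> | /eqP/negPf ne_yt]; [by constructor 1 | constructor 2].
  move/mem_subseq/(_ y): xy_s; rewrite !inE ne_yt eqxx orbT => /(_ isT) y_s.
  by rewrite /= eqxx sub1seq.
rewrite /= ne_zt; case: (x =P t) => [_ y_s z_s | _ xy_s /(IHs xy_s) //].
rewrite sub1seq in y_s; case/splitPr: y_s z_s => s1 s2.
rewrite mem_cat inE => /or3P[z_s1 | /eqP-> | z_s2]; [|by constructor 1|].
  constructor 2; apply: (@cat_subseq _ [:: z] [:: y]);
    by rewrite sub1seq ?mem_head.
constructor 3; apply: (@cat_subseq _ [::] [:: y; z]); first exact: sub0seq.
by rewrite /= eqxx sub1seq.
Qed.

Lemma subseq_count2 (T : eqType) (a : T) s : 1 < count_mem a s -> subseq [:: a; a] s.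
Proof.
move=> a_s; apply: subseq_trans (filter_subseq (pred1 a) s).
have /all_pred1P -> := filter_all (pred1 a) s; rewrite size_filter.
by case: (count_mem a s) a_s => [|[|j]] //= _; rewrite !eqxx sub0seq.
Qed.

Lemma subseq_cat_notin (T : eqType) (x : T) s p t :
  x \notin p -> subseq (x :: s) (p ++ t) = subseq (x :: s) t.
Proof. by elim: p => //= y p IHp; rewrite inE negb_or => /andP[/negPf-> /IHp]. Qed.

(** * Sufficient conditions for avoidance *)

Lemma pattern_free_subseq (v w : seq nat) : subseq v w -> pattern_free w -> pattern_free v.
Proof.
move=> v_w [w1 w2 w3]; split=> [a b | a b d lt_ab lt_bd | a b d lt_ab lt_bd] sub_v.
- exact: w1 (subseq_trans sub_v v_w).
- exact: w2 lt_ab lt_bd (subseq_trans sub_v v_w).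
- exact: w3 lt_ab lt_bd (subseq_trans sub_v v_w).
Qed.

(** Each of the patterns contains two letters, not necessarily adjacent, that are
    in the wrong order for [rotated_geq k], whatever values realise the pattern. *)
Lemma pattern_free_rotated k (w : seq nat) : pairwise (rotated_geq k) w -> pattern_free w.
Proof.
move=> k_w; split=> [a b | a b d lt_ab lt_bd | a b d lt_ab lt_bd] sub_w;
  have := subseq_pairwise sub_w k_w; rewrite /= !andbT.
- move=> /and3P[/and3P[ab _ _] /andP[_ ba] _].
  by apply: (@rotated_geq_anti k); rewrite ab ba.
- by rewrite /rotated_geq; do !case: ifP; lia.
- by rewrite /rotated_geq; do !case: ifP; lia.
Qed.

(** A largest letter cannot be the first letter of 123 or of 231, and as the two
    copies are adjacent the first of them cannot enclose a pair. *)
Lemma pattern_free_cons_max2 n w : all (gtn n) w -> pattern_free w -> pattern_free [:: n, n & w].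
Proof.
move=> /allP lt_n [w1 w2 w3].
have n_w : n \notin w by apply/negP=> /lt_n /=; rewrite ltnn.
have le_n s x : subseq s [:: n, n & w] -> x \in s -> x <= n.
  by move=> /mem_subseq sub_s /sub_s; rewrite !inE => /or3P[/eqP->|/eqP->|/lt_n/ltnW].
have drop_nn x s : x != n -> subseq (x :: s) [:: n, n & w] -> subseq (x :: s) w.
  by move=> /negPf ne_xn; rewrite /= ne_xn /= ne_xn.
split=> [a b | a b d lt_ab lt_bd | a b d lt_ab lt_bd].
- case: (eqVneq a n) => [-> | ne_an]; last by move/(drop_nn _ _ ne_an); exact: w1.
  rewrite /= eqxx; case: (b =P n) => [-> // | _] /mem_subseq/(_ n).
  by rewrite (negPf n_w) !inE eqxx !orbT => /(_ isT).
- case: (eqVneq a n) => [a_n abd | ne_an]; last by move/(drop_nn _ _ ne_an); exact: w2.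
  by have := @le_n _ d abd; rewrite !inE eqxx !orbT => /(_ isT); lia.
- case: (eqVneq b n) => [b_n bda | ne_bn]; last by move/(drop_nn _ _ ne_bn); exact: w3.
  by have := @le_n _ d bda; rewrite !inE eqxx !orbT => /(_ isT); lia.
Qed.

(** The ascents of 123 and of 231 avoid the smallest letter of a decreasing word
    with 1 inserted: 1 could only be the smallest letter of the pattern, and the two
    others form an ascent of the decreasing word. Nestings are excluded among the
    letters other than 1 by monotonicity, inside the pair of 1 since q has no
    repetition, and around it since p and r are disjoint. *)
Lemma pattern_free_insert_ones p q r :
    all (ltn 1) (p ++ q ++ r) -> pairwise geq (p ++ q ++ r) ->
    uniq q -> ~~ has (mem p) r ->
  pattern_free (p ++ 1 :: q ++ 1 :: r).
Proof.
move=> gt1 geq_s uniq_q dis_pr; set w := p ++ _.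
have w_s : [seq x <- w | x != 1] = p ++ q ++ r.
  rewrite /w !filter_cat /= filter_cat /= -!filter_cat; apply/all_filterP.
  by apply: sub_all gt1 => x /=; lia.
have ge1 v x : subseq v w -> x \in v -> 0 < x.
  move=> /mem_subseq sub_v /sub_v x_w; case: (x =P 1) => [-> // | /eqP ne_x1].
  have: x \in p ++ q ++ r by rewrite -w_s mem_filter ne_x1.
  by move/(allP gt1) => /=; lia.
have sub_s v : subseq v w -> all (fun x => x != 1) v -> subseq v (p ++ q ++ r).
  by move=> sub_v v1; rewrite -w_s subseq_filter v1.
have desc a b d : 0 < a -> a < b -> b < d -> subseq [:: b; d] w -> False.
  move=> a0 lt_ab lt_bd /sub_s bd_s.
  have b1 : 1 < b by exact: leq_ltn_trans lt_ab.
  have d1 : 1 < d by exact: ltn_trans lt_bd.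
  have := subseq_pairwise (bd_s _) geq_s; rewrite /= !neq_ltn b1 d1 !orbT => /(_ isT).
  rewrite !andbT.
  by rewrite leqNgt lt_bd.
move: gt1; rewrite !all_cat => /and3P[p1 q1 r1].
have notin1 t : all (ltn 1) t -> 1 \notin t.
  by move=> gt1; apply/negP=> /(allP gt1) /=.
split=> [a b | a b d lt_ab lt_bd | a b d lt_ab lt_bd] sub_w.
- case: (a =P 1) => [a1 | /eqP a1].
    case: (b =P 1) => [-> // | /eqP /negPf b1]; exfalso.
    (* The two 1 of the nesting are those around q, so b b is read inside q. *)
    move: sub_w; rewrite a1 /w subseq_cat_notin ?notin1 //= .
    rewrite -subseq_rev (rev_cat q) (rev_cons 1) cat_rcons subseq_cat_notin /=; last first.
      by rewrite mem_rev notin1.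
    move=> bb_q; have := subseq_uniq bb_q; rewrite rev_uniq uniq_q => /(_ isT).
    by rewrite /= inE eqxx.
  case: (b =P 1) => [b1 | /eqP b1].
    exfalso; move: sub_w; rewrite b1 /w => sub_w.
    (* Were a absent from p, it would be read after the first 1, and only one 1
       is left there; reversal gives the same for r. *)
    have a_p : a \in p.
      apply: contraT => a_p; move: sub_w; rewrite subseq_cat_notin //= (negPf a1).
      move/(leq_count_subseq (pred1 1)); rewrite /= (negPf a1) count_cat /=.
      by rewrite !(count_memPn _) ?notin1.
    have a_r : a \in r.
      apply: contraT => a_r; move: sub_w; rewrite -subseq_rev (rev_cat p) (rev_cons 1).
      rewrite (rev_cat q) (rev_cons 1) !cat_rcons -catA subseq_cat_notin ?mem_rev //=.
      rewrite (negPf a1) => /(leq_count_subseq (pred1 1)).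
      rewrite /= (negPf a1) count_cat /=.
      by rewrite !(count_memPn _) ?mem_rev ?notin1.
    by case/hasP: dis_pr; exists a.
  have := subseq_pairwise (sub_s _ sub_w _) geq_s.
  by rewrite /= a1 b1 => /(_ isT); lia.
- have a0 : 0 < a by apply: (ge1 _ _ sub_w); rewrite mem_head.
  have bd_w : subseq [:: b; d] w by apply: subseq_trans sub_w; exact: subseq_cons.
  exact: desc _ _ a0 lt_ab lt_bd bd_w.
- have a0 : 0 < a by apply: (ge1 _ _ sub_w); rewrite !inE eqxx !orbT.
  have bd_w : subseq [:: b; d] w.
    by apply: subseq_trans sub_w; exact: (prefix_subseq [:: b; d] [:: a]).
  exact: desc _ _ a0 lt_ab lt_bd bd_w.
Qed.

(** * The first letters of an avoider *)

Definition avoider (n : nat) (w : seq nat) : Prop :=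
  perm_eq w (down 0 n) /\ pattern_free w.

(** The second disjunct only occurs for k = 1: there is then no letter smaller
    than k to separate the two copies of k from the block of larger letters. *)
Lemma avoider_first_lt n k u : avoider n (k :: u) -> k < n ->
  k :: u = down 0 k ++ down k (n - k) \/
  k = 1 /\ u = [:: n, 1, n & down 1 (n - 2)].
Proof.
move=> [perm_w free_w] lt_kn.
have: k \in k :: u by rewrite mem_head.
rewrite (perm_mem perm_w) mem_down; case: k => [|k] // in perm_w free_w lt_kn * => _.
have k_u : k.+1 \in u.
  apply: contraT => /count_memPn k_u; have /seq.permP/(_ (pred1 k.+1)) := perm_w.
  by rewrite count_mem_down /= eqxx k_u; lia.
case/splitPr: k_u => u1 u2 in perm_w free_w *.
have perm_s : perm_eq (u1 ++ u2) (down 0 k ++ down k.+1 (n - k.+1)).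
  have eq_down : down 0 n = down k.+1 (n - k.+1) ++ [:: k.+1, k.+1 & down 0 k].
    by rewrite -{1}(subnKC (ltnW lt_kn)) down_add.
  apply/seq.permP=> a; have /seq.permP/(_ a) := perm_w.
  by rewrite eq_down /= !count_cat /=; lia.
have n_s : n \in u1 ++ u2 by rewrite (perm_mem perm_s) mem_cat !mem_down; lia.
have sub_s v : subseq v (u1 ++ u2) -> subseq (k.+1 :: v) (k.+1 :: u1 ++ k.+1 :: u2).
  move=> v_s; rewrite /= eqxx; apply: subseq_trans v_s _.
  by apply: cat_subseq; rewrite ?subseq_cons.
(* Two letters in the wrong order make, with the leading k, a 123 or a 231;
   only when both are below k is the letter n needed as a third one. *)
have s_pair : pairwise (rotated_geq k.+1) (u1 ++ u2).
  apply: subseq2_pairwise => x y xy_s.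
  have mem_s z : z \in [:: x; y] -> z != k.+1 /\ z <= n.
    move/(mem_subseq xy_s); rewrite (perm_mem perm_s) mem_cat !mem_down; lia.
  have [x_k le_xn] := mem_s x (mem_head _ _).
  have [y_k le_yn] : y != k.+1 /\ y <= n by apply: mem_s; rewrite !inE eqxx orbT.
  apply: contraT; rewrite /rotated_geq => not_xy.
  have kxy := sub_s _ xy_s.
  have xy_k : x < k.+1 -> x < y -> y < k.+1 -> False.
    move=> lt_xk lt_xy lt_yk; case: (subseq_insert xy_s n_s) => [||xyn].
    - lia.
    - by move/sub_s; apply: (no_231 free_w lt_yk lt_kn).
    - apply: (no_123 free_w lt_xy (d := n)); first by lia.
      exact: cons_subseq (sub_s _ xyn).
  have kx_y : k.+1 < x -> y < k.+1 -> False.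
    by move=> lt_kx lt_yk; apply: (no_231 free_w lt_yk lt_kx kxy).
  have k_xy : k.+1 < x -> x < y -> False.
    by move=> lt_kx lt_xy; apply: (no_123 free_w lt_kx lt_xy kxy).
  exfalso; move: not_xy; case: ifP; lia.
have eq_s : u1 ++ u2 = down 0 k ++ down k.+1 (n - k.+1).
  apply: (pairwise_eq (@rotated_geq_anti k.+1)) => //.
  apply: subseq_pairwise (pairwise_rotated_down k.+1 (n - k.+1)).
  by rewrite [down 0 k.+1]/= !cat_cons; do 2 apply: (subseq_trans _ (subseq_cons _ _)).
(* The second k is located by the number of letters of u1 preceding it. *)
case: u1 => [|x u1] in perm_w free_w eq_s n_s sub_s {perm_s s_pair} *.
  by left; rewrite /= add0n -eq_s.
case: k => [|k] in lt_kn perm_w free_w eq_s n_s sub_s *.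
  right; split=> //; case: n => [|[|n]] // in lt_kn eq_s n_s perm_w *.
  rewrite subn1 in eq_s; case: eq_s => eq_x; case: u1 => [|y u1] /= in perm_w free_w n_s sub_s *.
    by move=> ->; rewrite eq_x !subSS subn0.
  case=> eq_y _; rewrite eq_x eq_y in free_w.
  (* Two letters between the two 1: this is 1 n n 1. *)
  have: 1 = 1 + n.+1; last by lia.
  by apply: (no_nesting free_w); rewrite /= !eqxx sub1seq mem_cat mem_head orbT.
(* One letter between the two k: this is the 123 made of k-1, k and n. *)
exfalso; case: eq_s => eq_x; case: u1 => [|y u1] /= in free_w n_s {sub_s perm_w} *.
  move=> _; apply: (@no_123 _ free_w x k.+2 n) => //; first by rewrite eq_x.
  apply: (subseq_trans _ (subseq_cons _ _)); rewrite /= !eqxx sub1seq.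
  by move: n_s; rewrite inE => /predU1P[n_x|//]; lia.
case=> eq_y _; rewrite eq_x eq_y in free_w.
(* Two letters between the two k: this is k (k-1) (k-1) k. *)
have: k.+2 = 0 + k.+1; last by lia.
by apply: (no_nesting free_w); rewrite /= !eqxx sub1seq mem_cat mem_head orbT.
Qed.

Lemma avoider_first_max n k u :
    2 < n -> avoider n [:: n, k & u] -> k < n ->
  k = 1 /\
  (u = [:: n, 1 & down 1 (n - 2)] \/ u = [:: n, n.-1, 1, n.-1 & down 1 (n - 3)]).
Proof.
case: n => [|[|[|m]]] // _ [perm_w free_w] lt_kn.
have count_w x : count_mem x [:: m.+3, k & u] = (0 < x <= m.+3).*2.
  by rewrite (seq.permP perm_w) count_mem_down.
have k_gt0 : 0 < k.
  by have: k \in down 0 m.+3; [rewrite -(perm_mem perm_w) !inE eqxx orbT | rewrite mem_down; lia].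
(* For 1 < k the second n would have every 1 on its left, by 231 with the leading
   k, so that the pair of n would enclose the pair of 1. *)
have k1 : k = 1.
  apply: contraTeq k_gt0 => ne_k1; rewrite -leqNgt leqNgt; apply/negP=> k_gt0.
  have n_u : m.+3 \in u.
    apply: contraT => /count_memPn n_u; have := count_w m.+3.
    by rewrite /= n_u; lia.
  case/splitPr: n_u => u1 u2 in perm_w free_w count_w.
  have lt_1k : 1 < k by lia.
  have not1_u2 : count_mem 1 u2 = 0.
    apply/count_memPn/negP=> u2_1; apply: (no_231 free_w lt_1k lt_kn).
    apply: (subseq_trans _ (subseq_cons _ _)); rewrite /= eqxx.
    apply: (@cat_subseq _ [::] [:: m.+3; 1]); first exact: sub0seq.
    by rewrite /= eqxx sub1seq.
  have: subseq [:: 1; 1] u1.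
    apply: subseq_count2; have := count_w 1.
    by rewrite /= count_cat /= not1_u2; lia.
  move=> u1_11; have: m.+3 = 1; last by [].
  apply: (no_nesting free_w).
  apply: (@cat_subseq _ [:: m.+3] [:: 1; 1; m.+3] [:: m.+3; k]).
    by rewrite sub1seq mem_head.
  by apply: (@cat_subseq _ [:: 1; 1] [:: m.+3]); rewrite // sub1seq mem_head.
split=> //; subst k => {k_gt0}.
have u_1 : 1 \in u.
  apply: contraT => /count_memPn u_1; have := count_w 1.
  by rewrite /= u_1; lia.
case/splitPr: u_1 => u1 u2 in perm_w free_w {count_w} *.
have perm_s : perm_eq (u1 ++ u2) (m.+3 :: down 1 m.+1).
  have eq_down : down 0 m.+3 = [:: m.+3, m.+3 & down 1 m.+1] ++ [:: 1; 1].
    exact: (down_add 0 1 m.+2).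
  apply/seq.permP=> a; have /seq.permP/(_ a) := perm_w.
  by rewrite eq_down /= !count_cat /=; lia.
have sub_s v : subseq v (u1 ++ u2) -> subseq (1 :: v) [:: m.+3, 1 & u1 ++ 1 :: u2].
  move=> v_s; apply: (subseq_trans _ (subseq_cons _ _)).
  rewrite /=; apply: subseq_trans v_s _.
  by apply: cat_subseq; rewrite ?subseq_cons.
have eq_s : u1 ++ u2 = [:: m.+3, m.+2, m.+2 & down 1 m].
  have -> : [:: m.+3, m.+2, m.+2 & down 1 m] = m.+3 :: down 1 m.+1 by [].
  apply: (@pairwise_eq _ geq) => [x y | | |//].
  - by rewrite /=; lia.
  - apply: subseq2_pairwise => x y xy_s; rewrite /= leqNgt; apply/negP=> lt_xy.
    apply: (no_123 free_w _ lt_xy (sub_s _ xy_s)).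
    have: x \in u1 ++ u2 by rewrite (mem_subseq xy_s) ?mem_head.
    by rewrite (perm_mem perm_s) inE mem_down; lia.
  - rewrite pairwise_cons pairwise_geq_down andbT.
    by apply/allP=> x; rewrite mem_down /=; lia.
(* The second 1 comes after 0, 1, 2 or at least 3 letters of the decreasing word;
   the first case is n 1 1 n, the last contains 1 (n-1) (n-1) 1. *)
case: u1 => [|x [|y [|z u1]]] /= in free_w eq_s {perm_w perm_s sub_s} *.
- exfalso; have: m.+3 = 1; last by [].
  by apply: (no_nesting free_w); rewrite eq_s /= !eqxx.
- by case: eq_s => -> ->; left.
- by case: eq_s => -> -> ->; right; rewrite (_ : m.+3 - 3 = m); [|lia].
exfalso; case: eq_s => _ y_m z_m _; have: 1 = m.+2; last by [].
apply: (no_nesting free_w).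
apply: (@cat_subseq _ [:: 1] [:: m.+2; m.+2; 1] [:: m.+3; 1]).
  by rewrite sub1seq !inE.
apply: (subseq_trans _ (subseq_cons _ _)).
by rewrite y_m z_m /= !eqxx sub1seq mem_cat mem_head orbT.
Qed.

(** * The list of avoiders *)

Definition split_words (n : nat) : seq (seq nat) :=
  [seq down 0 k ++ down k (n - k) | k <- iota 1 n.-1].

Definition interleaved_words (n : nat) : seq (seq nat) :=
  [:: [:: 1, n, 1, n & down 1 (n - 2)];
      [:: n, 1, n, 1 & down 1 (n - 2)];
      [:: n, 1, n, n.-1, 1, n.-1 & down 1 (n - 3)]].

(** [avoiders m] lists the avoiders of size m + 2. The recursion starts at size 2
    because the interleaved words need a letter n - 1 different from 1. *)
Fixpoint avoiders (m : nat) : seq (seq nat) :=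
  if m is m'.+1 then
    [seq [:: m.+2, m.+2 & w] | w <- avoiders m']
      ++ split_words m.+2 ++ interleaved_words m.+2
  else [:: [:: 1; 1; 2; 2]; [:: 1; 2; 1; 2]; [:: 2; 1; 2; 1]; [:: 2; 2; 1; 1]].

Lemma avoidersS m :
  avoiders m.+1 = [seq [:: m.+3, m.+3 & w] | w <- avoiders m]
                    ++ split_words m.+3 ++ interleaved_words m.+3.
Proof. by []. Qed.

Lemma avoider_cons_max2 n w :
  avoider n.+1 [:: n.+1, n.+1 & w] <-> avoider n w.
Proof.
split=> -[perm_w free_w]; split.
- by move: perm_w; rewrite /= !perm_cons.
- by apply: pattern_free_subseq free_w; do 2 apply: (subseq_trans _ (subseq_cons _ _)).
- by rewrite /= !perm_cons.
- apply: pattern_free_cons_max2 => //; apply/allP=> x.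
  by rewrite (perm_mem perm_w) mem_down /=; lia.
Qed.

Lemma split_words_avoider n w : w \in split_words n -> avoider n w.
Proof.
case/mapP=> k; rewrite mem_iota => k_n ->; split.
  by rewrite perm_catC -{1}(add0n k) -down_add subnKC //; lia.
exact/pattern_free_rotated/pairwise_rotated_down.
Qed.

Lemma insert_ones_avoider n p q r :
    p ++ q ++ r = down 1 n -> uniq q -> ~~ has (mem p) r ->
  avoider n.+1 (p ++ 1 :: q ++ 1 :: r).
Proof.
move=> eq_s uniq_q dis_pr; split.
  apply/seq.permP=> a; rewrite -(add1n n) (down_add 0 1 n) -eq_s.
  by rewrite !count_cat /= count_cat /= add0n; lia.
apply: pattern_free_insert_ones => //; rewrite eq_s ?pairwise_geq_down //.
by apply/allP=> x; rewrite mem_down => /andP[].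
Qed.

Lemma interleaved_words_avoider n w :
  2 < n -> w \in interleaved_words n -> avoider n w.
Proof.
case: n => [|[|[|m]]] // _; rewrite /interleaved_words !subSS !subn0.
have not_down : m.+3 \notin down 1 m.+1 by rewrite mem_down; lia.
rewrite !inE => /or3P[] /eqP->.
- by apply: (@insert_ones_avoider _ [::] [:: m.+3] (m.+3 :: down 1 m.+1));
    rewrite ?has_pred0 //; elim: (down 1 m).
- apply: (@insert_ones_avoider _ [:: m.+3] [:: m.+3] (down 1 m.+1)) => //.
  by apply: contra not_down => /hasP[x x_down /predU1P[<-|//]].
apply: (@insert_ones_avoider _ [:: m.+3] [:: m.+3; m.+2] (m.+2 :: down 1 m)) => //.
  by rewrite /= inE; lia.
apply/hasPn=> x; rewrite inE => /predU1P[-> | x_down].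
  by rewrite /= inE; lia.
by move: x_down; rewrite mem_down /= !inE; lia.
Qed.

Lemma avoiders2P w : avoider 2 w <-> w \in avoiders 0.
Proof.
split=> [[perm_w free_w] | ].
  have nest a b : a != b -> w <> [:: a; b; b; a].
    by move=> /eqP ne_ab w_ab; apply/ne_ab/(no_nesting free_w); rewrite w_ab.
  have: w \in permutations (down 0 2) by rewrite mem_permutations.
  have -> : permutations (down 0 2) =
    [:: [:: 2; 1; 2; 1]; [:: 1; 2; 2; 1]; [:: 2; 2; 1; 1];
        [:: 1; 2; 1; 2]; [:: 2; 1; 1; 2]; [:: 1; 1; 2; 2]] by vm_compute.
  rewrite !in_cons in_nil orbF.
  have /eqP/negPf -> := @nest 1 2 isT; have /eqP/negPf -> := @nest 2 1 isT.
  by do ![case/predU1P=> [-> // |]] => /eqP ->.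
rewrite !inE => /or4P[] /eqP->.
- exact: (@split_words_avoider 2).
- exact: (@insert_ones_avoider 1 [::] [:: 2] [:: 2]).
- exact: (@insert_ones_avoider 1 [:: 2] [:: 2] [::]).
- by split=> //; apply: (@pattern_free_rotated 2).
Qed.

Lemma avoidersP m w : avoider m.+2 w <-> w \in avoiders m.
Proof.
elim: m w => [|m IHm] w; first exact: avoiders2P.
split=> [w_av | ]; last first.
  rewrite avoidersS !mem_cat => /or3P[/mapP[v /IHm v_av ->] | |].
  - exact/avoider_cons_max2.
  - exact: split_words_avoider.
  - exact: interleaved_words_avoider.
have [perm_w _] := w_av.
have w_range x : x \in w -> 0 < x <= m.+3 by rewrite (perm_mem perm_w) mem_down.
have split_mem k : 0 < k < m.+3 -> 
    down 0 k ++ down k (m.+3 - k) \in split_words m.+3.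
  by move=> k_range; apply/mapP; exists k; rewrite // mem_iota; lia.
rewrite avoidersS !mem_cat; apply/or3P.
case: w => [|k [|l u]] in w_av perm_w w_range *; try by have := perm_size perm_w.
have k_range : 0 < k <= m.+3 by apply: w_range; rewrite mem_head.
have l_range : 0 < l <= m.+3 by apply: w_range; rewrite !inE eqxx orbT.
case: (ltngtP k m.+3) => [lt_k | | k_max]; [|lia|subst k].
  case: (avoider_first_lt w_av lt_k) => [-> | [-> ->]].
    by constructor 2; apply: split_mem; lia.
  by constructor 3; rewrite !inE eqxx.
case: (ltngtP l m.+3) => [lt_l | | l_max]; [|lia|subst l].
  have [//|-> [] ->] := avoider_first_max _ w_av lt_l; constructor 3;
    by rewrite !inE eqxx ?orbT.
by constructor 1; apply/mapP; exists u => //; apply/IHm/avoider_cons_max2.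
Qed.

(** The first two letters tell the three families of words apart: n n, then k k
    with k < n, then two different letters. *)
Lemma take2_split n w : w \in split_words n ->
  exists2 k, k < n & take 2 w = [:: k; k].
Proof.
case/mapP=> -[|k]; rewrite mem_iota => k_range ->; first by lia.
by exists k.+1; [lia | rewrite /= take0].
Qed.

Lemma uniq_avoiders m : uniq (avoiders m).
Proof.
elim: m => // m IHm; set n := m.+3.
rewrite avoidersS -/n cat_uniq; apply/and3P; split.
- by rewrite map_inj_uniq // => w v [].
- apply/hasPn=> w; rewrite mem_cat => w_split; apply/mapP=> -[v _ eq_w].
  case/orP: w_split => [/take2_split[k lt_kn] | ].
    by rewrite eq_w /= take0 => -[eq_nk]; lia.
  by rewrite eq_w !inE => /or3P[] /eqP[].
rewrite cat_uniq; apply/and3P; split.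
- rewrite map_inj_in_uniq ?iota_uniq // => -[|k] [|l];
    by rewrite !mem_iota //= => _ _ [] ->.
- apply/hasPn=> w w_int; apply/negP=> /take2_split[k lt_kn].
  by move: w_int; rewrite !inE => /or3P[] /eqP-> /= [] *; lia.
rewrite /= !inE !eqseq_cons /=; lia.
Qed.

Lemma size_avoiders m :
  (size (avoiders m)).*2 + 6 = m.+2 ^ 2 + 5 * m.+2.
Proof.
elim: m => // m IHm; rewrite avoidersS !size_cat !size_map size_iota /=.
by move: IHm; rewrite -!mulnn; nia.
Qed.

Lemma c_avoiders m : c m.+2 [:: [:: 1; 2; 3]; [:: 2; 3; 1]] = size (avoiders m).
Proof.
apply/perm_size/uniq_perm; last 1 first.
- move=> w; rewrite !mem_filter mem_permutations /= andbT.
  apply/idP/idP=> [/and3P[/andP[w3 w4] /andP[w1 w2] perm_w] | /avoidersP[perm_w]].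
    apply/avoidersP; split; last by apply/pattern_freeP; rewrite w1 w2 w3 w4.
    by rewrite (permPr (perm_down_double_word _)).
  move/pattern_freeP=> /and4P[-> -> -> ->] /=.
  by rewrite -(permPr (perm_down_double_word _)).
- by rewrite !filter_uniq // permutations_uniq.
exact: uniq_avoiders.
Qed.

Local Open Scope ring_scope.

Theorem theorem2p5 (n : nat) (hn : (2 <= n)%N) :
  (c n [:: [:: 1%N; 2%N; 3%N]; [:: 2%N; 3%N; 1%N]])%:R
    = (n%:R ^+ 2 + 5%:R * n%:R - 6%:R) / 2%:R :> rat.
Proof.
case: n => [|[|m]] // in hn *; rewrite c_avoiders.
have /(congr1 (fun j => j%:R : rat)) := size_avoiders m.
by rewrite !natrD natrX -mul2n !natrM; lra.
Qed.
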